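(* Fix $\Gamma z_0\in\mathcal M$. For any sequence of positive numbers $\{c_n\}_{n\in\mathbb N}$ there exists a sequence $\{y_n\}_{n\in\mathbb N}$ with $0<y_n<c_n$ for every $n$ such that for Lebesgue-almost every $x\in\mathbb R/\mathbb Z$, $$\limsup_{n\to\infty}\frac{\inf_{\Gamma z\in\mathcal R_n(x,y_n)}d_{\mathcal M}(\Gamma z_0,\Gamma z)}{\log\log n}\ge1.$$
   Context: $\mathcal M=\Gamma\backslash\mathbb H$ with $\Gamma=\mathrm{SL}_2(\mathbb Z)$; $d_{\mathcal M}(\Gamma z_1,\Gamma z_2)=\inf_{\gamma\in\Gamma}d_{\mathbb H}(\gamma z_1,z_2)$ with $d_{\mathbb H}$ the hyperbolic distance. $\mathcal R_n(x,y)=\{\Gamma(x+\tfrac jn+iy):0\le j\le n-1\}$. *)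

(* Defs.v *)
From HB Require Import structures.
From mathcomp Require Import all_boot all_order all_algebra.
From mathcomp Require Import all_classical all_reals all_analysis.
Set Implicit Arguments. Unset Strict Implicit. Unset Printing Implicit Defensive.
Import Order.TTheory GRing.Theory Num.Theory.
Local Open Scope ring_scope.
Local Open Scope classical_set_scope.

(* A point z = x + i y of the upper half plane H is represented by the pair
   (x, y) of reals (with y > 0). *)

Definition SL2Z : set 'M[int]_2 := [set g | \det g = 1].

Section Hyp.
Variable R : realType.

(* Moebius action of g = [[a,b],[c,d]] on z = x + iy:
   g z = (a z + b)/(c z + d); with |cz+d|^2 = (cx+d)^2 + (cy)^2,
   Re(gz) = ((ax+b)(cx+d) + a c y^2)/|cz+d|^2,  Im(gz) = y/|cz+d|^2. *)
Definition mobius (g : 'M[int]_2) (z : R * R) : R * R :=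
  let a : R := (g 0 0)%:~R in let b : R := (g 0 1)%:~R in
  let c : R := (g 1 0)%:~R in let d : R := (g 1 1)%:~R in
  let x := z.1 in let y := z.2 in
  let D := (c * x + d) ^+ 2 + (c * y) ^+ 2 in
  (((a * x + b) * (c * x + d) + a * c * y ^+ 2) / D, y / D).

Definition arcosh (t : R) : R := ln (t + Num.sqrt (t ^+ 2 - 1)).

Definition dH (z w : R * R) : R :=
  arcosh (1 + ((z.1 - w.1) ^+ 2 + (z.2 - w.2) ^+ 2) / (2 * z.2 * w.2)).

Definition dM (z1 z2 : R * R) : R :=
  inf [set dH (mobius g z1) z2 | g in SL2Z].

(* R_n(x,y) = { Gamma (x + j/n + i y) : 0 <= j <= n-1 }, via representatives *)
Definition Rn (n : nat) (x y : R) : set (R * R) :=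
  [set (x + j%:R / n%:R, y) | j in [set j : nat | (j < n)%N]].

Definition min_dist (z0 : R * R) (n : nat) (x y : R) : R :=
  inf [set dM z0 z | z in Rn n x y].

End Hyp.

(* Main.v *)
Require Import Defs.
From HB Require Import structures.
From mathcomp Require Import all_boot all_order all_algebra.
From mathcomp Require Import all_classical all_reals all_analysis.
From mathcomp Require Import measurable_realfun ring lra.
Import Order.TTheory GRing.Theory Num.Theory.
Import numFieldNormedType.Exports.
Local Open Scope ring_scope.
Local Open Scope classical_set_scope.

(* For n >= 1 put H = 1 + log n and y = 1/(2 H n^2 P^2) with P large. If x is
   within y of a fraction p/(nq) with q <= P, then for every j the point x + j/n
   is within y of (p + jq)/(nq), whose denominator is still at most nP; hence
   every point x + j/n + iy lies at height at least H in the cusp, at distance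
   at least log H - O(1) from z0. As P grows, the set of such x occupies at least
   a proportion 1/(128 n H) of every fixed interval: by Dirichlet's theorem the
   fractions with q between P/16 and P number at least a constant times n P^2 per
   unit length, and they are 1/(nP^2)-separated. So P = P_n can be chosen
   successively to make these sets nearly independent of the earlier ones, and
   since sum 1/(n log n) diverges, almost every x lies in infinitely many. *)

Lemma det_mx2 (K : comNzRingType) (g : 'M[K]_2) :
  \det g = g 0 0 * g 1 1 - g 0 1 * g 1 0.
Proof.
rewrite (expand_det_row _ 0) !big_ord_recl big_ord0 addr0 /cofactor !det_mx11.
rewrite !mxE /= add0n expr0 expr1 mul1r mulN1r mulrN.
by congr (g _ _ * g _ _ - g _ _ * g _ _); apply: val_inj.
Qed.

(** * Heights in the cusps and the distance on the modular surface *)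

Section Height.
Context {R : realType}.
Implicit Types (z w : R * R) (c d : R).

(* For coprime integers c and d, this is the imaginary part of g z for any g in
   SL2(Z) with bottom row (c, d). *)
Definition row_height c d z : R := z.2 / ((c * z.1 + d) ^+ 2 + (c * z.2) ^+ 2).

Lemma row_norm_gt0 c d z : 0 < z.2 -> (c != 0) || (d != 0) ->
  0 < (c * z.1 + d) ^+ 2 + (c * z.2) ^+ 2.
Proof.
move=> z2; have [->|c0 _] := eqVneq c 0 => /=.
  by move=> d0; rewrite !mul0r add0r expr0n addr0 exprn_even_gt0.
apply: ltr_wpDl; first exact: sqr_ge0.
by rewrite exprn_even_gt0//= mulf_neq0// gt_eqF.
Qed.

(** The cocycle relation for denominators: if [(r, s)] is the bottom row of [g], then [c * gz + d]
    equals [c' * z + d'] divided by [r * z + s], where [(c', d')] is the row [(c, d)] times [g]. *)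
Lemma row_height_mobius c d z (g : 'M[int]_2) : 0 < z.2 -> g \in SL2Z ->
  row_height c d (mobius g z) =
  row_height (c * (g 0 0)%:~R + d * (g 1 0)%:~R)
             (c * (g 0 1)%:~R + d * (g 1 1)%:~R) z.
Proof.
move=> z2; rewrite inE /SL2Z/= det_mx2 => detg.
rewrite /row_height /mobius/=.
set p := (g 0 0)%:~R; set q := (g 0 1)%:~R.
set r := (g 1 0)%:~R; set s := (g 1 1)%:~R.
have {detg} detg : p * s - q * r = 1 :> R.
  by rewrite /p /q /r /s -!intrM -intrB detg.
case: z z2 => x y /= y0.
have N0 : 0 < (r * x + s) ^+ 2 + (r * y) ^+ 2.
  apply: (row_norm_gt0 r s (x, y)) => //.
  apply/negPn/negP; rewrite negb_or !negbK => /andP[/eqP r0 /eqP s0].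
  by move: detg; rewrite r0 s0 !mulr0 subrr => /esym/eqP; rewrite oner_eq0.
set N := (r * x + s) ^+ 2 + (r * y) ^+ 2 in N0 *.
have NE : N = (r * x + s) ^+ 2 + (r * y) ^+ 2 by [].
set D := ((c * p + d * r) * x + (c * q + d * s)) ^+ 2 + ((c * p + d * r) * y) ^+ 2.
have -> : (c * (((p * x + q) * (r * x + s) + p * r * y ^+ 2) / N) + d) ^+ 2 +
  (c * (y / N)) ^+ 2 = D / N.
  have -> : D / N = D * N / N ^+ 2 by field; rewrite gt_eqF.
  (* Squared modulus of [(c' z + d')] times the conjugate of [(r z + s)]: the imaginary part reduces
     to [c * y] times the determinant. *)
  have -> : D * N = (c * ((p * x + q) * (r * x + s) + p * r * y ^+ 2) + d * N) ^+ 2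
      + (c * (p * s - q * r) * y) ^+ 2 by rewrite /D NE; ring.
  by rewrite detg mulr1; field; rewrite gt_eqF.
by rewrite invf_div mulrA divfK ?gt_eqF.
Qed.

(** A nonzero integer has square at least 1: if [c = 0], the term in [d] bounds the height by [z.2],
    and otherwise the term [(c * z.2) ^+ 2] bounds it by the inverse of [z.2]. The sum covers both
    cases, uniformly in the row. *)
Lemma row_height_int_le (c d : int) z : 0 < z.2 -> (c != 0) || (d != 0) ->
  row_height c%:~R d%:~R z <= z.2 + z.2^-1.
Proof.
move=> z2 cd; have N0 := row_norm_gt0 c%:~R d%:~R z z2.
rewrite !intr_eq0 in N0; have {}N0 := N0 cd.
have sq1 (a : int) : a != 0 -> 1 <= a%:~R ^+ 2 :> R.
  by move=> a0; rewrite -rmorphXn/= (ler_int _ 1) -gtz0_ge1 exprn_even_gt0.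
rewrite /row_height ler_pdivrMr// mulrDl.
have [c0|c0] := eqVneq c 0.
  rewrite c0 /= in cd.
  have D1 : 1 <= (c%:~R * z.1 + d%:~R) ^+ 2 + (c%:~R * z.2) ^+ 2 :> R.
    by rewrite c0 !mul0r add0r expr0n addr0 sq1.
  apply: (@le_trans _ _ (z.2 * ((c%:~R * z.1 + d%:~R) ^+ 2 + (c%:~R * z.2) ^+ 2))).
    by rewrite ler_peMr// ltW.
  by rewrite lerDl mulr_ge0// ?invr_ge0 ltW.
apply: (@le_trans _ _ (z.2^-1 * ((c%:~R * z.1 + d%:~R) ^+ 2 + (c%:~R * z.2) ^+ 2))).
  rewrite mulrDr; apply: ler_wpDl; first by rewrite mulr_ge0 ?invr_ge0 ?sqr_ge0 ?ltW.
  have -> : z.2^-1 * (c%:~R * z.2) ^+ 2 = c%:~R ^+ 2 * z.2 by field; rewrite gt_eqF.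
  by rewrite ler_peMl ?sq1 ?ltW.
by rewrite lerDr mulr_ge0// ltW.
Qed.

Lemma ln_le_arcosh (t : R) : 1 <= t -> ln t <= arcosh t.
Proof.
move=> t1; rewrite /arcosh ler_ln ?posrE ?lerDl ?sqrtr_ge0//.
  exact: lt_le_trans t1.
by apply: ltr_wpDr; [exact: sqrtr_ge0|exact: lt_le_trans t1].
Qed.

(* The height along a fixed row is Lipschitz, up to a factor 2, for the metric
   log: this is the triangle inequality for the Busemann function at the cusp. *)
Lemma ln_row_height_le_dH c d z w : 0 < z.2 -> 0 < w.2 -> (c != 0) || (d != 0) ->
  ln (row_height c d w / (2 * row_height c d z)) <= dH z w.
Proof.
move=> z2 w2 cd.
have Nz := row_norm_gt0 c d z z2 cd; have Nw := row_norm_gt0 c d w w2 cd.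
have t1 : 1 <= 1 + ((z.1 - w.1) ^+ 2 + (z.2 - w.2) ^+ 2) / (2 * z.2 * w.2).
  by rewrite lerDl divr_ge0// ?addr_ge0 ?sqr_ge0// !mulr_ge0// ltW.
apply: le_trans (ln_le_arcosh _ t1).
rewrite /row_height ler_ln ?posrE.
- set N := (c * z.1 + d) ^+ 2 + (c * z.2) ^+ 2 in Nz *.
  set M := (c * w.1 + d) ^+ 2 + (c * w.2) ^+ 2 in Nw *.
  have -> : w.2 / M / (2 * (z.2 / N)) = (w.2 ^+ 2 * N) / (2 * z.2 * w.2 * M).
    by field; rewrite !gt_eqF.
  rewrite ler_pdivrMr ?mulr_gt0//.
  have -> : (1 + ((z.1 - w.1) ^+ 2 + (z.2 - w.2) ^+ 2) / (2 * z.2 * w.2)) *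
    (2 * z.2 * w.2 * M) = ((z.1 - w.1) ^+ 2 + z.2 ^+ 2 + w.2 ^+ 2) * M.
    by field; rewrite !gt_eqF.
  rewrite -subr_ge0.
  (* Once denominators are cleared, the two sides differ by a sum of two squares. *)
  have -> : ((z.1 - w.1) ^+ 2 + z.2 ^+ 2 + w.2 ^+ 2) * M - w.2 ^+ 2 * N =
    ((z.1 - w.1) * (c * w.1 + d) - c * w.2 ^+ 2) ^+ 2 + (z.2 * (c * w.1 + d)) ^+ 2.
    by rewrite /M /N; ring.
  by rewrite addr_ge0 ?sqr_ge0.
- by rewrite !(divr_gt0, mulr_gt0)// ?invr_gt0 !(divr_gt0, mulr_gt0).
- exact: lt_le_trans t1.
Qed.

(** The height of the row [(c, d)] at [g z] is the height at [z] of another nonzero integer row, so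
    it is bounded independently of [g]. The Lipschitz bound then applies to all translates at once
    and passes to the infimum. *)
Lemma ln_row_height_le_dM (c d : int) (T : R) z w : 0 < z.2 -> 0 < w.2 ->
  (c != 0) || (d != 0) -> 0 < T -> T <= row_height c%:~R d%:~R w ->
  ln T - ln (2 * (z.2 + z.2^-1)) <= dM z w.
Proof.
move=> z2 w2 cd T0 TH; apply: lb_le_inf.
  by exists (dH (mobius 1%:M z) w), 1%:M => //; rewrite /SL2Z/= det1.
move=> _ [g gS <-]; have [gS1] := (gS, mem_set gS).
have cdR : (c%:~R != 0 :> R) || (d%:~R != 0 :> R) by rewrite !intr_eq0.
move: gS1; rewrite /SL2Z/= det_mx2 => detg gS1.
(* Multiplying the new row by the inverse of [g] recovers [(c, d)], so it cannot vanish. *)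
have cd' : (c * g 0 0 + d * g 1 0 != 0) || (c * g 0 1 + d * g 1 1 != 0).
  apply/negPn/negP; rewrite negb_or !negbK => /andP[/eqP e1 /eqP e2].
  have ec : c = 0.
    rewrite -[c]mulr1 -detg.
    have -> : c * (g 0 0 * g 1 1 - g 0 1 * g 1 0) =
      (c * g 0 0 + d * g 1 0) * g 1 1 - (c * g 0 1 + d * g 1 1) * g 1 0 by ring.
    by rewrite e1 e2 !mul0r subrr.
  have ed : d = 0.
    rewrite -[d]mulr1 -detg.
    have -> : d * (g 0 0 * g 1 1 - g 0 1 * g 1 0) =
      (c * g 0 1 + d * g 1 1) * g 0 0 - (c * g 0 0 + d * g 1 0) * g 0 1 by ring.
    by rewrite e1 e2 !mul0r subrr.
  by move: cd; rewrite ec ed eqxx.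
have gz2 : 0 < (mobius g z).2.
  rewrite /= divr_gt0//; apply: row_norm_gt0 => //.
  rewrite !intr_eq0; apply/negPn/negP; rewrite negb_or !negbK => /andP[/eqP e1 /eqP e2].
  by move: detg; rewrite e1 e2 !mulr0 subrr.
apply: le_trans (ln_row_height_le_dH _ _ _ _ gz2 w2 cdR).
have hz : row_height c%:~R d%:~R (mobius g z) <= z.2 + z.2^-1.
  by rewrite row_height_mobius// -!intrM -!intrD row_height_int_le.
have hz0 : 0 < row_height c%:~R d%:~R (mobius g z).
  by rewrite divr_gt0// row_norm_gt0.
move: hz hz0; move: (row_height _ _ (mobius g z)) => h hz hz0.
have C0 : 0 < z.2 + z.2^-1 by rewrite addr_gt0// invr_gt0.
have H0 : 0 < row_height c%:~R d%:~R w by exact: lt_le_trans TH.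
rewrite -ln_div ?posrE ?mulr_gt0// ler_ln ?posrE; last 2 first.
- by rewrite divr_gt0// mulr_gt0.
- by rewrite divr_gt0// mulr_gt0.
apply: ler_pM => //; first exact: ltW.
  by rewrite invr_ge0 ltW// mulr_gt0.
by rewrite lef_pV2 ?posrE ?mulr_gt0// ler_pM2l.
Qed.

Lemma min_dist_ge (T : R) z (n q : nat) (p : int) (x y : R) : 0 < z.2 ->
  (0 < n)%N -> (0 < q)%N -> 0 < y -> 0 < T ->
  `|x - p%:~R / (n * q)%:R| < y -> 2 * (n * q)%:R ^+ 2 * y * T <= 1 ->
  ln T - ln (2 * (z.2 + z.2^-1)) <= min_dist z n x y.
Proof.
move=> z2 n0 q0 y0 T0 xp yT.
have nq0 : 0 < (n * q)%:R :> R by rewrite ltr0n muln_gt0 n0.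
apply: lb_le_inf; first by exists (dM z (x + 0%:R / n%:R, y)), (x + 0%:R / n%:R, y) => //; exists 0%N.
move=> _ [_ [j _ <-] <-].
(* On the [j]-th point this row takes the value [n q (x - p/(nq))], the same for all [j]. Hence each
   point has height at least [1 / (2 (nq)^2 y)] along its row. *)
apply: (@ln_row_height_le_dM (n * q)%:Z (- (p + j%:Z * q%:Z))) => //.
  by rewrite -lt0n muln_gt0 n0 q0.
rewrite /row_height /= ler_pdivlMr; last first.
  by apply: (row_norm_gt0 (n * q)%:R _ (x + j%:R / n%:R, y)) => //; rewrite gt_eqF.
have -> : (n * q)%:Z%:~R * (x + j%:R / n%:R) + (- (p + j%:Z * q%:Z))%:~R =
   (n * q)%:R * (x - p%:~R / (n * q)%:R) :> R.
  rewrite rmorphN rmorphD rmorphM /= -!pmulrn !natrM.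
  by field; rewrite !pnatr_eq0 -!lt0n n0 q0.
rewrite -!pmulrn [in leLHS]exprMn [X in _ + X]exprMn.
have xy : (x - p%:~R / (n * q)%:R) ^+ 2 <= y ^+ 2.
  by rewrite -(real_normK (num_real _)) lerXn2r ?nnegrE// ?normr_ge0 ltW.
apply: (@le_trans _ _ ((2 * (n * q)%:R ^+ 2 * y * T) * y)).
  rewrite [leRHS](_ : _ = T * ((n * q)%:R ^+ 2 * y ^+ 2 + (n * q)%:R ^+ 2 * y ^+ 2)); last by ring.
  by rewrite ler_pM2l// lerD2r ler_pM2l// exprn_gt0.
by rewrite ler_piMl// ltW.
Qed.

End Height.

(** * Neighbourhoods of fractions *)

Section NearFractions.
Context {R : realType}.
Let mu : {measure set measurableTypeR R -> \bar R} := @lebesgue_measure R.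

(** Pigeonhole: the fractional parts of the [P + 1] multiples [0, u, ..., P u] fall into [P]
    half-open boxes of length [1/P]. *)
Lemma dirichlet_approximation (u : R) (P : nat) : (0 < P)%N ->
  exists q : nat, exists p : int,
    (0 < q <= P)%N /\ `|q%:R * u - p%:~R| < P%:R^-1.
Proof.
move=> P0; have P0R : 0 < P%:R :> R by rewrite ltr0n.
pose frac (x : R) := x - (Num.floor x)%:~R.
have frac_itv x : 0 <= frac x < 1.
  have := floor_itv x; rewrite intrD => /andP[h1 h2].
  by rewrite subr_ge0 h1 ltrBlDl.
have tr k : (Num.truncn (P%:R * frac (k%:R * u))%R < P)%N.
  have /andP[h1 h2] := frac_itv (k%:R * u).
  by rewrite truncn_lt_nat ?mulr_ge0// ?ltW// gtr_pMr.
pose f (k : 'I_P.+1) := Ordinal (tr k).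
have /injectivePn[k [l kl fkl]] : ~~ injectiveb f.
  apply/negP => /injectiveP /leq_card; by rewrite !card_ord ltnn.
have {f fkl} : Num.truncn (P%:R * frac (k%:R * u)) =
    Num.truncn (P%:R * frac (l%:R * u)) by case: fkl.
wlog lekl : k l kl / (k < l)%N.
  move=> W; have [|lk|/val_inj e] := ltngtP k l; first exact: W.
    by move=> /esym; apply: W; rewrite // eq_sym.
  by rewrite e eqxx in kl.
move=> e; exists (l - k)%N, (Num.floor (l%:R * u) - Num.floor (k%:R * u)).
split; first by rewrite subn_gt0 lekl leq_subLR (leq_trans (leq_ord l))// leq_addl.
rewrite natrB ?(ltnW lekl)// intrB.
rewrite [X in `|X|](_ : _ = frac (l%:R * u) - frac (k%:R * u)); last by rewrite /frac; ring.
rewrite -(ltr_pM2l P0R) -{1}(gtr0_norm P0R) -normrM mulfV ?gt_eqF// mulrBr.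
have tP i : 0 <= P%:R * frac (i%:R * u).
  by rewrite mulr_ge0//; case/andP: (frac_itv (i%:R * u)).
have /andP[k1 k2] := truncn_itv (tP k); have /andP[l1 l2] := truncn_itv (tP l).
rewrite -e -natr1 in l1 l2; rewrite -natr1 in k2.
by rewrite ltr_norml; apply/andP; split; lra.
Qed.

(** Cesaro means of a null sequence tend to 0. This absorbs the error [+ 1] made in counting the
    fractions of each small denominator. *)
Lemma near_harmonic_sum_le (e : R) : 0 < e ->
  \forall m \near \oo, \sum_(k < m) k.+1%:R^-1 <= m%:R * e.
Proof.
move=> e0; have := cesaro (@cvg_harmonic R) => /cvgr_le/(_ _ e0)[N _ HN].
exists N.+1 => // -[//|m] /= Nm.
have := HN m Nm; rewrite /arithmetic_mean /= ler_pdivrMl ?ltr0n//.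
by rewrite /series/= big_mkord.
Qed.

Lemma bigcup_ball_nth (s : seq R) (r : R) :
  \bigcup_(x in [set x : R | x \in s]) ball x r = \big[setU/set0]_(i < size s) ball (nth 0 s i) r.
Proof.
rewrite -(bigcup_mkord (size s) (fun i => ball (nth 0 s i) r)); apply/seteqP; split => [z [x /= xs zx]|z [i /= si zi]].
  by exists (index x s); rewrite ?nth_index//= index_mem.
by exists (nth 0 s i) => //=; exact: mem_nth.
Qed.

Lemma measurable_bigcup_ball (s : seq R) (r : R) :
  measurable (\bigcup_(x in [set x : R | x \in s]) ball x r : set (measurableTypeR R)).
Proof. by apply: open_measurable; apply: bigcup_open => ? _; exact: ball_open. Qed.

Lemma lebesgue_measure_bigcup_ball_le (s : seq R) (r : R) : 0 <= r ->
  (mu (\bigcup_(x in [set x : R | x \in s]) ball x r) <= ((size s)%:R * (r *+ 2))%:E)%E.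
Proof.
move=> r0; have -> : (size s)%:R * (r *+ 2) = \sum_(i < size s) r *+ 2.
  by rewrite sumr_const card_ord mulr_natl.
rewrite -sumEFin.
have -> : (\sum_(i < size s) (r *+ 2)%:E = \sum_(i < size s) mu (ball (nth 0%R s i) r))%E.
  by apply: eq_bigr => i _; rewrite -(lebesgue_measure_ball (nth 0%R s i) r0).
apply: (@content_subadditive _ _ _ mu (\bigcup_(x in [set x : R | x \in s]) ball x r)
  (fun i => ball (nth 0 s i) r) (size s)).
- by move=> k _; apply: open_measurable; exact: ball_open.
- exact: measurable_bigcup_ball.
- by rewrite bigcup_ball_nth.
Qed.

Lemma lebesgue_measure_bigcup_ball_separated (s : seq R) (r : R) : 0 <= r ->
  uniq s -> {in s &, forall x y, x != y -> r *+ 2 <= `|x - y|} ->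
  mu (\bigcup_(x in [set x : R | x \in s]) ball x r) = ((size s)%:R * (r *+ 2))%:E.
Proof.
move=> r0 us sep; rewrite bigcup_ball_nth measure_bigsetU_ord//=.
- under eq_bigr do rewrite (lebesgue_measure_ball _ r0).
  by rewrite sumEFin sumr_const card_ord mulr_natl.
- by move=> i; apply: open_measurable; exact: ball_open.
- apply/trivIsetP => i j _ _ ij; apply/seteqP; split => // z [].
  rewrite /ball/= => zi zj.
  have := sep _ _ (mem_nth 0 (ltn_ord i)) (mem_nth 0 (ltn_ord j)).
  rewrite nth_uniq// => /(_ ij); rewrite leNgt => /negP; apply.
  rewrite (_ : nth 0 s i - nth 0 s j = (nth 0 s i - z) - (nth 0 s j - z)); last by ring.
  by rewrite (le_lt_trans (ler_normB _ _))// mulr2n ltrD.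
Qed.

(** * Fractions with denominator a multiple of [n]: enumeration, separation, covering *)

Definition near_fractions (n P : nat) (y : R) : set R :=
  \bigcup_(q in [set q | (0 < q <= P)%N])
    \bigcup_(p in [set: int]) ball (p%:~R / (n * q)%:R : R) y.

Lemma open_near_fractions n P y : open (near_fractions n P y).
Proof. by do 2 (apply: bigcup_open => ? _); exact: ball_open. Qed.

(** The list starts at the first multiple of [1/N] beyond [a]; its end may reach or pass [b]. It
    serves through its completeness on []a, b[] and the bound on its size. *)
Definition fractions (a b : R) (N : nat) : seq R :=
  [seq (Num.floor (N%:R * a) + 1 + i%:Z)%:~R / N%:R
     | i <- iota 0 (Num.truncn (N%:R * (b - a))).+1].

Lemma size_fractions_le a b N : a <= b ->
  (size (fractions a b N))%:R <= N%:R * (b - a) + 1.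
Proof.
move=> ab; rewrite size_map size_iota -natr1 lerD2r.
by have /andP[] := @truncn_itv _ (N%:R * (b - a)) (mulr_ge0 (ler0n _ _) (eq_ind_r is_true ab (subr_ge0 _ _))).
Qed.

Lemma fractionsP a b N x : x \in fractions a b N -> exists p : int, x = p%:~R / N%:R.
Proof. by move=> /mapP[i _ ->]; eexists. Qed.

Lemma mem_fractions a b N (p : int) : (0 < N)%N ->
  a < p%:~R / N%:R < b -> p%:~R / N%:R \in fractions a b N.
Proof.
move=> N0 /andP[ap pb]; have N0R : 0 < N%:R :> R by rewrite ltr0n.
rewrite ltr_pdivlMr// mulrC in ap; rewrite ltr_pdivrMr// mulrC in pb.
have fp : (Num.floor (N%:R * a) < p)%R by rewrite floor_lt_int.
have [i pE] : exists i : nat, p = Num.floor (N%:R * a) + 1 + i%:Z.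
  exists (absz (p - (Num.floor (N%:R * a) + 1))%R).
  by rewrite gez0_abs ?subr_ge0 ?lezD1// [RHS]addrC subrK.
apply/mapP; exists i; last by rewrite -pE.
rewrite mem_iota /= add0n ltnS truncn_ge_nat; last first.
  rewrite mulr_ge0// subr_ge0 -(ler_pM2l N0R); exact: ltW (lt_trans ap pb).
have := floorD1_gt (N%:R * a); rewrite pE !intrD -pmulrn in pb *.
by rewrite mulrBr => h; lra.
Qed.

(** Over the common denominator [n q r], at most [n P^2], two distinct fractions have numerators
    that differ by at least 1. *)
Lemma fractions_separated (n P q r : nat) (p s : int) : (0 < n)%N ->
  (0 < q <= P)%N -> (0 < r <= P)%N ->
  p%:~R / (n * q)%:R != s%:~R / (n * r)%:R :> R ->
  (n%:R * P%:R ^+ 2)^-1 <= `|p%:~R / (n * q)%:R - s%:~R / (n * r)%:R| :> R.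
Proof.
move=> n0 /andP[q0 qP] /andP[r0 rP].
have [n0R q0R r0R] : [/\ 0 < n%:R :> R, 0 < q%:R :> R & 0 < r%:R :> R].
  by rewrite !ltr0n.
have -> : p%:~R / (n * q)%:R = p%:~R * r%:R / (n%:R * (q%:R * r%:R)) :> R.
  by rewrite natrM; field; rewrite !gt_eqF.
have -> : s%:~R / (n * r)%:R = s%:~R * q%:R / (n%:R * (q%:R * r%:R)) :> R.
  by rewrite natrM; field; rewrite !gt_eqF.
move=> ne; rewrite -mulrBl normrM normfV (gtr0_norm (mulr_gt0 n0R (mulr_gt0 q0R r0R))).
apply: (@le_trans _ _ (1 / (n%:R * (q%:R * r%:R)))).
  have P0 : 0 < P%:R :> R by rewrite ltr0n (leq_trans q0).
  rewrite div1r lef_pV2 ?posrE ?mulr_gt0 ?exprn_gt0//.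
  by rewrite ler_pM2l// expr2 ler_pM// ler_nat.
rewrite ler_pM2r ?invr_gt0 ?mulr_gt0//.
rewrite !pmulrn -!intrM -intrB -intr_norm (ler_int _ 1) -gtz0_ge1 normr_gt0 subr_eq0.
by apply: contra ne => /eqP e; rewrite !pmulrn -!intrM e.
Qed.

(* For q > m the Dirichlet intervals of radius 1/(16 n q m) have length comparable
   to 1/(n m^2); the margin (b - a)/8 keeps the small balls inside ]a, b[. *)
Definition large_fractions (a b : R) (n m : nat) : seq R :=
  undup [seq x <- flatten [seq fractions a b (n * q) | q <- iota m.+1 (15 * m)]
        | a + (b - a) / 8 < x < b - (b - a) / 8].

Lemma large_fractionsP a b n m x : x \in large_fractions a b n m ->
  a + (b - a) / 8 < x < b - (b - a) / 8 /\
  exists q, exists p : int, (0 < q <= 16 * m)%N /\ x = p%:~R / (n * q)%:R.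
Proof.
rewrite mem_undup mem_filter => /andP[-> /flattenP[s /mapP[q]]].
rewrite mem_iota => /andP[mq qm] -> /fractionsP[p xp]; split => //.
by exists q, p; split => //; rewrite (leq_ltn_trans _ mq).
Qed.

Lemma mem_large_fractions a b n m q (p : int) : (0 < n)%N -> a < b ->
  (m < q <= 16 * m)%N ->
  a + (b - a) / 8 < p%:~R / (n * q)%:R < b - (b - a) / 8 ->
  p%:~R / (n * q)%:R \in large_fractions a b n m.
Proof.
move=> n0 ab /andP[mq qm] h; rewrite mem_undup mem_filter h/=.
apply/flattenP; exists (fractions a b (n * q)).
  apply: map_f; rewrite mem_iota mq/= addSn ltnS.
  by rewrite -{1}(mul1n m) -mulnDl.
apply: mem_fractions; first by rewrite muln_gt0 n0 (leq_ltn_trans _ mq).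
by case/andP: h => h1 h2; apply/andP; split; lra.
Qed.

(** Dirichlet's theorem for [n * u] with bound [16 m] puts [u] close to some [p/(nq)]. Index [k < m]
    collects the denominator [q = k + 1]; index [m] collects all [q > m], with the radius enlarged
    to that of [q = m]. *)
Lemma fractions_cover a b n m : (0 < n)%N -> (0 < m)%N -> a < b ->
  (16 * m)%:R^-1 <= (b - a) / 8 ->
  `]a + (b - a) / 4, b - (b - a) / 4[ `<=`
    \big[setU/set0]_(k < m.+1)
      if k == m :> nat then
        \bigcup_(x in [set x : R | x \in large_fractions a b n m])
          ball x (n%:R * m%:R * (16 * m)%:R)^-1
      else \bigcup_(x in [set x : R | x \in fractions a b (n * k.+1)])
          ball x (n%:R * k.+1%:R * (16 * m)%:R)^-1.
Proof.
move=> n0 m0 ab Pab u /=; rewrite in_itv/= => /andP[au ub].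
have P0 : (0 < 16 * m)%N by rewrite muln_gt0.
have n0R : 0 < n%:R :> R by rewrite ltr0n.
have m0R : 0 < m%:R :> R by rewrite ltr0n.
have P0R : 0 < (16 * m)%:R :> R by rewrite ltr0n.
have [q [p [/andP[q0 qP] hqp]]] := dirichlet_approximation (n%:R * u) _ P0.
have q0R : 0 < q%:R :> R by rewrite ltr0n.
have nq0R : 0 < n%:R * q%:R :> R by rewrite mulr_gt0.
have hx : `|p%:~R / (n * q)%:R - u| < (n%:R * q%:R * (16 * m)%:R)^-1.
  have -> : p%:~R / (n * q)%:R - u = - ((q%:R * (n%:R * u) - p%:~R) / (n%:R * q%:R)).
    by rewrite natrM; field; rewrite !gt_eqF.
  by rewrite normrN normrM normfV (gtr0_norm nq0R) [ltRHS]invfM [ltLHS]mulrC ltr_pM2l ?invr_gt0.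
have hx8 : `|p%:~R / (n * q)%:R - u| < (b - a) / 8.
  apply: (lt_le_trans hx); apply: le_trans Pab.
  rewrite lef_pV2 ?posrE ?mulr_gt0//; apply: ler_peMl; first exact: ltW.
  by rewrite -natrM ler1n muln_gt0 n0.
have {}hx8 : a + (b - a) / 8 < p%:~R / (n * q)%:R < b - (b - a) / 8.
  by move: hx8; rewrite ltr_norml => /andP[h1 h2]; apply/andP; split; lra.
rewrite -(bigcup_mkord m.+1 (fun k => if k == m :> nat then
        \bigcup_(x in [set x : R | x \in large_fractions a b n m])
          ball x (n%:R * m%:R * (16 * m)%:R)^-1
      else \bigcup_(x in [set x : R | x \in fractions a b (n * k.+1)])
          ball x (n%:R * k.+1%:R * (16 * m)%:R)^-1)).
have [qm|mq] := leqP q m.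
  exists q.-1; rewrite /= prednK// ?(leq_trans qm)// ltn_eqF.
    exists (p%:~R / (n * q)%:R) => //=.
    apply: mem_fractions; first by rewrite muln_gt0 n0.
    by case/andP: hx8 => h1 h2; apply/andP; split; lra.
  by rewrite prednK.
exists m => //=; rewrite eqxx; exists (p%:~R / (n * q)%:R) => /=.
  by apply: mem_large_fractions; rewrite // mq.
apply: (lt_le_trans hx).
rewrite lef_pV2 ?posrE ?mulr_gt0// ler_pM2r// ler_pM2l// ler_nat; exact: ltnW.
Qed.

(** * Counting fractions of large denominator, and the measure near them *)

Lemma lebesgue_measure_itvoo (a b : R) : a <= b ->
  mu (`]a, b[%classic : set R) = (b - a)%:E.
Proof.
move=> ab; apply: (etrans (lebesgue_measure_itv (`]a, b[%R : interval R))).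
rewrite /= lte_fin.
by case: ltgtP ab => // ->; rewrite subrr.
Qed.

Lemma near_inv_mul16_le (e : R) : 0 < e ->
  \forall m \near \oo, (0 < m)%N /\ (16 * m)%:R^-1 <= e.
Proof.
move=> e0; near=> m.
have m0 : (0 < m)%N by near: m; exists 1%N.
have m0R : 0 < m%:R :> R by rewrite ltr0n.
split => //; rewrite invf_ple ?posrE ?ltr0n ?muln_gt0//.
apply: (@le_trans _ _ m%:R); first by near: m; exact: nbhs_infty_ger.
by rewrite ler_nat leq_pmull.
Unshelve. all: by end_near. Qed.

(** The middle half of []a, b[] has length [(b - a)/2]. Denominators up to [m] cover at most
    [(b - a)/8] by the main term of their count and [(b - a)/8] by its error term. The remaining
    [(b - a)/4] must be covered by balls of length [1/(8 n m^2)] about the large fractions. *)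
Lemma near_size_large_fractions_ge (a b : R) n : (0 < n)%N -> a < b ->
  \forall m \near \oo, (0 < m)%N /\
    2 * n%:R * m%:R ^+ 2 * (b - a) <= (size (large_fractions a b n m))%:R.
Proof.
move=> n0 ab; have L0 : 0 < b - a by rewrite subr_gt0.
have L80 : 0 < (b - a) / 8 by rewrite divr_gt0.
near=> m.
have [m0 Pab] : (0 < m)%N /\ (16 * m)%:R^-1 <= (b - a) / 8.
  by near: m; exact: near_inv_mul16_le.
have harm : \sum_(k < m) k.+1%:R^-1 <= m%:R * (b - a).
  by near: m; exact: near_harmonic_sum_le.
split => //.
have n1R : 1 <= n%:R :> R by rewrite ler1n.
have n0R : 0 < n%:R :> R by rewrite ltr0n.
have m0R : 0 < m%:R :> R by rewrite ltr0n.
have PE : (16 * m)%:R = 16 * m%:R :> R by rewrite natrM.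
set S := large_fractions a b n m.
pose F k : set R := if k == m :> nat then
        \bigcup_(x in [set x : R | x \in S])
          ball x (n%:R * m%:R * (16 * m)%:R)^-1
      else \bigcup_(x in [set x : R | x \in fractions a b (n * k.+1)])
          ball x (n%:R * k.+1%:R * (16 * m)%:R)^-1.
have mF k : measurable (F k : set (measurableTypeR R)).
  by rewrite /F; case: ifP => _; exact: measurable_bigcup_ball.
have itvle : (mu (`](a + (b - a) / 4)%R, (b - (b - a) / 4)%R[%classic : set R)
    <= (\sum_(k < m.+1) mu (F k))%R)%E.
  apply: content_subadditive => //; exact: fractions_cover.
rewrite lebesgue_measure_itvoo in itvle; last by lra.
rewrite big_ord_recr/= in itvle.
have FmE : (mu (F m) <= ((size S)%:R * ((n%:R * m%:R * (16 * m)%:R)^-1 *+ 2))%:E)%E.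
  rewrite /F eqxx; apply: lebesgue_measure_bigcup_ball_le.
  by rewrite PE invr_ge0 !mulr_ge0// ltW.
have FkE (k : 'I_m) : (mu (F k) <= ((b - a) / (8 * m%:R) + (8 * m%:R)^-1 * k.+1%:R^-1)%:E)%E.
  have r0 : 0 <= (n%:R * k.+1%:R * (16 * m)%:R)^-1 :> R.
    by rewrite PE invr_ge0 !mulr_ge0// ltW.
  rewrite /F ltn_eqF//; apply: (le_trans (lebesgue_measure_bigcup_ball_le _ _ r0)).
  have k0R : 0 < k.+1%:R :> R by rewrite ltr0n.
  rewrite lee_fin.
  apply: (@le_trans _ _ (((n * k.+1)%:R * (b - a) + 1) *
      ((n%:R * k.+1%:R * (16 * m)%:R)^-1 *+ 2))).
    apply: ler_wpM2r; first exact: mulrn_wge0.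
    exact/size_fractions_le/ltW.
  rewrite natrM PE.
  have -> : (n%:R * k.+1%:R * (b - a) + 1) * ((n%:R * k.+1%:R * (16 * m%:R))^-1 *+ 2)
     = (b - a) / (8 * m%:R) + (8 * m%:R)^-1 * k.+1%:R^-1 * n%:R^-1.
    by field; rewrite !gt_eqF.
  rewrite lerD2l ler_piMr ?invf_le1// mulr_ge0// invr_ge0 ?mulr_ge0// ltW.
have {FkE FmE} := le_trans itvle (leeD (lee_sum _ (fun k _ => FkE k)) FmE).
rewrite sumEFin -EFinD lee_fin big_split/= sumr_const card_ord -mulr_sumr.
have : (8 * m%:R)^-1 * (\sum_(k < m) k.+1%:R^-1) <= (8 * m%:R)^-1 * (m%:R * (b - a)).
  by rewrite ler_pM2l// invr_gt0 mulr_gt0.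
have -> : (8 * m%:R)^-1 * (m%:R * (b - a)) = (b - a) / 8 by field; rewrite gt_eqF.
have -> : (b - a) / (8 * m%:R) *+ m = (b - a) / 8.
  by rewrite -mulr_natr; field; rewrite gt_eqF.
rewrite PE.
have -> : (size S)%:R * ((n%:R * m%:R * (16 * m%:R))^-1 *+ 2) = 
  (size S)%:R / (2 * n%:R * m%:R ^+ 2) / 4 :> R by field; rewrite !gt_eqF.
move=> h1 h2.
rewrite mulrC -ler_pdivlMr ?mulr_gt0 ?exprn_gt0//; lra.
Unshelve. all: by end_near. Qed.

Lemma near_lebesgue_measure_itv_setD_near_fractions (n : nat) (H a b : R) :
  (0 < n)%N -> 1 <= H -> a <= b ->
  \forall m \near \oo,
    (mu (`]a, b[ `\` near_fractions n (16 * m) (2 * H * n%:R ^+ 2 * (16 * m)%:R ^+ 2)^-1)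
     <= ((1 - (128 * H * n%:R)^-1) * (b - a))%:E)%E.
Proof.
move=> n0 H1; rewrite le_eqVlt => /predU1P[<-|ab].
  near=> m; rewrite set_itvoo0 set0D measure0 subrr mulr0//.
have L80 : 0 < (b - a) / 8 by rewrite divr_gt0// subr_gt0.
near=> m.
have [m0 Pab] : (0 < m)%N /\ (16 * m)%:R^-1 <= (b - a) / 8.
  by near: m; exact: near_inv_mul16_le.
have [_ szS] : (0 < m)%N /\
    2 * n%:R * m%:R ^+ 2 * (b - a) <= (size (large_fractions a b n m))%:R.
  by near: m; exact: near_size_large_fractions_ge.
have n1R : 1 <= n%:R :> R by rewrite ler1n.
have n0R : 0 < n%:R :> R by rewrite ltr0n.
have m0R : 0 < m%:R :> R by rewrite ltr0n.
have P1R : 1 <= (16 * m)%:R :> R by rewrite ler1n muln_gt0.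
have P0R : 0 < (16 * m)%:R :> R by rewrite ltr0n muln_gt0.
have H0 : 0 < H by exact: lt_le_trans H1.
set P := (16 * m)%N in Pab P1R P0R *.
set y := (2 * H * n%:R ^+ 2 * P%:R ^+ 2)^-1.
have y0 : 0 < y by rewrite invr_gt0 !mulr_gt0 ?exprn_gt0.
(* The ball length is at most the separation of the fractions, so the balls about the large
   fractions are disjoint. *)
have y2 : y *+ 2 <= (n%:R * P%:R ^+ 2)^-1.
  have -> : y *+ 2 = (n%:R * P%:R ^+ 2)^-1 / (H * n%:R).
    by rewrite /y; field; rewrite !gt_eqF.
  apply: ler_piMr; first by rewrite ltW// invr_gt0 mulr_gt0// exprn_gt0.
  rewrite invf_le1 ?mulr_gt0//.
  by rewrite (le_trans H1)// ler_peMr// ltW.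
have y8 : y <= (b - a) / 8.
  apply: le_trans Pab; apply: (@le_trans _ _ (y *+ 2)); first by rewrite mulr2n lerDl ltW.
  apply: (le_trans y2); rewrite lef_pV2 ?posrE ?mulr_gt0 ?exprn_gt0//.
  rewrite expr2 mulrA ler_peMl ?(ltW P0R)// (le_trans n1R)// ler_peMr// ltW.
set E := near_fractions n P y.
have mE : measurable (E : set (measurableTypeR R)).
  by apply: open_measurable; exact: open_near_fractions.
have mI : measurable (`]a, b[%classic : set (measurableTypeR R)).
  exact: measurable_itv.
have lb : (((128 * H * n%:R)^-1 * (b - a))%:E <= mu (`]a, b[ `&` E))%E.
  pose U := \bigcup_(x in [set x : R | x \in large_fractions a b n m]) ball x y.
  apply: (@le_trans _ _ (mu U)).
    rewrite /U lebesgue_measure_bigcup_ball_separated ?(ltW y0) ?undup_uniq//.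
      rewrite lee_fin.
      (* With [P = 16 m], [2 n m^2 (b - a)] balls of length [1/(256 H n^2 m^2)] have total length
         [(b - a)/(128 H n)]. *)
      apply: (@le_trans _ _ (2 * n%:R * m%:R ^+ 2 * (b - a) * (y *+ 2))).
        rewrite /y /P natrM le_eqVlt; apply/orP; left; apply/eqP.
        by field; rewrite !gt_eqF.
      by rewrite ler_wpM2r// mulrn_wge0// ltW.
    move=> _ _ /large_fractionsP[_ [q [p [qP ->]]]] /large_fractionsP[_ [r [s [rP ->]]]] ne.
    by apply: (le_trans y2); exact: fractions_separated.
  apply: le_measure; rewrite ?inE//; [exact: measurable_bigcup_ball|exact: measurableI|].
  move=> z [x /= /large_fractionsP[/andP[h1 h2] [q [p [qP xE]]]]] bx; split.
    move: bx h1 h2; rewrite /ball/= ltr_norml in_itv/= => /andP[? ?] ? ?.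
    by apply/andP; split; lra.
  by exists q => //; exists p => //; rewrite -xE.
have IE := lebesgue_measure_itvoo _ _ (ltW ab).
have fI (A : set (measurableTypeR R)) : measurable A -> A `<=` `]a, b[%classic -> mu A \is a fin_num.
  move=> mA AI; rewrite ge0_fin_numE// (@le_lt_trans _ _ (mu (`]a, b[%classic : set R)))//.
    by apply: le_measure; rewrite ?inE.
  by rewrite IE ltry.
have D : (mu (`]a, b[%classic : set R) = mu (`]a, b[ `\` E) + mu (`]a, b[ `&` E))%E.
  exact: (measureDI mu mI mE).
have f1 : mu (`]a, b[ `&` E) \is a fin_num by apply: fI; [exact: measurableI|exact: subIsetl].
have f2 : mu (`]a, b[ `\` E) \is a fin_num by apply: fI; [exact: measurableD|exact: subDsetl].
rewrite IE in D; move: D lb; rewrite -(fineK f1) -(fineK f2) -EFinD => -[D].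
by rewrite !lee_fin mulrBl mul1r D => ?; lra.
Unshelve. all: by end_near. Qed.

(** * From intervals to measurable sets of finite measure *)

Lemma open_itv_cover_bounds (F : set R) (e : R) : 0 < e -> (mu F < +oo)%E ->
  exists a b : nat -> R, [/\ forall k, a k <= b k,
    F `<=` \bigcup_k `]a k, b k[%classic &
    (\sum_(0 <= k <oo) (b k - a k)%:E <= mu F + e%:E)%E].
Proof.
move=> e0 Foo.
have [I [Iitv FI]] : exists2 I_, open_itv_cover F I_ &
    (\sum_(0 <= k <oo) wlength idfun (I_ k) <= mu F + e%:E)%E.
  have := @outer_measure_open_itv_cover R F.
  rewrite -[X in X = _]/(mu F) => FE.
  have : mu F \is a fin_num by rewrite ge0_fin_numE.
  rewrite FE => /lb_ereal_inf_adherent-/(_ _ e0)[_/= [I]] FI <- Fe.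
  by exists I => //; exact/ltW.
have [ab abE] := choice Iitv.
(* The maximum turns an empty interval with reversed endpoints into one of length 0. *)
move=> Ie; exists (fun k => (ab k).1), (fun k => Num.max (ab k).1 (ab k).2).
have IE k : I k = `](ab k).1, Num.max (ab k).1 (ab k).2[%classic.
  rewrite abE; case: leP => // /ltW h.
  by rewrite set_itvoo0 set_itv_ge// bnd_simp -leNgt.
split => [k||].
- by rewrite le_max lexx.
- by apply: (subset_trans FI) => x [k _ Ikx]; exists k => //; rewrite -IE.
- apply: le_trans Ie; apply: lee_nneseries => k.
    by move=> _ _; rewrite lee_fin subr_ge0 le_max lexx.
  move=> _; rewrite IE wlength_itv/= lte_fin.
  by case: ifPn => //; rewrite -leNgt lee_fin subr_le0.
Qed.

(* Subadditivity over the cover only needs an upper bound for the part of each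
   interval outside E m, so the intervals of the cover may overlap. *)
Lemma near_measure_setD_le (E : nat -> set R) (c : R) (F : set R) : 0 < c <= 1 ->
  (forall m, measurable (E m : set (measurableTypeR R))) ->
  (forall a b, a <= b -> \forall m \near \oo,
    (mu (`]a, b[ `\` E m) <= ((1 - c) * (b - a))%:E)%E) ->
  measurable (F : set (measurableTypeR R)) -> (mu F < +oo)%E ->
  \forall m \near \oo, (mu (F `\` E m) <= ((1 - c / 2) * fine (mu F))%:E)%E.
Proof.
move=> /andP[c0 c1] mE Eitv mF Foo.
have Ffin : mu F \is a fin_num by rewrite ge0_fin_numE.
have FDfin m : mu (F `\` E m) \is a fin_num.
  rewrite ge0_fin_numE//; apply: le_lt_trans Foo.
  by apply: le_measure; rewrite ?inE//; exact: measurableD.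
have [F0|F0] := eqVneq (mu F) 0%E.
  near=> m; rewrite F0 mulr0; apply: (@le_trans _ _ (mu F)); last by rewrite F0.
  by apply: le_measure; rewrite ?inE//; exact: measurableD.
have f0 : 0 < fine (mu F).
  by apply: fine_gt0; rewrite Foo andbT lt_neqAle eq_sym F0 measure_ge0.
pose f := fine (mu F); rewrite -/f in f0 *.
(* The cover exceeds [F] by at most [e], and its truncation loses at most [e] of length. Together
   they cost [(1 + c) e], at most half of the gain [c f]. *)
pose e := c * f / 4.
have e0 : 0 < e by rewrite divr_gt0// mulr_gt0.
have [a [b [ab Fab abe]]] := open_itv_cover_bounds F e e0 Foo.
have len0 k : (0 <= (b k - a k)%:E)%E by rewrite lee_fin subr_ge0.
have mI k : measurable (`]a k, b k[%classic : set (measurableTypeR R)).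
  exact: measurable_itv.
have muI k : mu (`]a k, b k[%classic : set R) = (b k - a k)%:E.
  exact: lebesgue_measure_itvoo.
have Fle : (mu F <= \sum_(0 <= k <oo) (b k - a k)%:E)%E.
  rewrite -(eq_eseriesr (fun k _ => muI k)).
  exact: measure_sigma_subadditive.
(* Only finitely many intervals can share one threshold for [m]; the first [K] carry almost all the
   length. *)
have [K HK] : exists K, ((f - e)%:E < \sum_(0 <= k < K) (b k - a k)%:E)%E.
  apply/not_existsP => HK.
  have : (\sum_(0 <= k <oo) (b k - a k)%:E <= (f - e)%:E)%E.
    apply: lime_le; first exact: is_cvg_nneseries.
    by near=> K; rewrite leNgt; apply/negP; exact: HK.
  move=> /(le_trans Fle); rewrite -(fineK Ffin) lee_fin -/f; lra.
have /filter_forall nearK : forall k : 'I_K, \forall m \near \oo,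
    (mu (`]a k, b k[ `\` E m) <= ((1 - c) * (b k - a k))%:E)%E.
  by move=> k; exact: Eitv.
near=> m.
have EK : forall k : 'I_K,
    (mu (`]a k, b k[ `\` E m) <= ((1 - c) * (b k - a k))%:E)%E.
  by near: m; exact: nearK.
(* The length that [E m] surely removes from the [k]-th interval; nothing is claimed from [K] on. *)
pose h k : \bar R := (if (k < K)%N then c * (b k - a k) else 0)%:E.
have h0 k : (0 <= h k)%E.
  by rewrite lee_fin; case: ifP => // _; rewrite mulr_ge0 ?subr_ge0// ltW.
have mID k : measurable (`]a k, b k[ `\` E m : set (measurableTypeR R)).
  exact: measurableD.
have s1 : (mu (F `\` E m) <= \sum_(0 <= k <oo) mu (`]a k, b k[ `\` E m))%E.
  apply: measure_sigma_subadditive => //; first exact: measurableD.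
  by rewrite -setD_bigcupl; exact: setSD.
have s2 : ((c * (f - e))%:E <= \sum_(0 <= k <oo) h k)%E.
  apply: le_trans (@nneseries_lim_ge _ _ xpredT 0%N K _) => //.
  rewrite (eq_big_nat _ _ (F2 := fun k => (c * (b k - a k))%:E)); last first.
    by move=> k /andP[_ kK]; rewrite /h kK.
  rewrite sumEFin -mulr_sumr lee_fin ler_pM2l//.
  by rewrite sumEFin lte_fin in HK; exact: ltW.
have s3 : (\sum_(0 <= k <oo) mu (`]a k, b k[ `\` E m) + \sum_(0 <= k <oo) h k
    <= \sum_(0 <= k <oo) (b k - a k)%:E)%E.
  rewrite -nneseriesD//; apply: lee_nneseries => [k _ _|k _].
    exact: adde_ge0.
  rewrite /h; case: ifP => kK.
    apply: (le_trans (leeD2r _ (EK (Ordinal kK)))).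
    by rewrite -EFinD lee_fin/=; lra.
  by rewrite adde0 -muI; apply: le_measure; rewrite ?inE//.
have := le_trans (leeD s1 s2) (le_trans s3 abe).
rewrite -(fineK (FDfin m)) -(fineK Ffin) -!EFinD !lee_fin -/f /e => h1.
have : c * (c * f) <= 1 * (c * f) by rewrite ler_pM2r// mulr_gt0.
by move: h1; nra.
Unshelve. all: by end_near. Qed.

End NearFractions.

(** * Infinitely many nearly independent sets *)

Section LimsupSet.
Context {R : realType}.
Let mu : {measure set measurableTypeR R -> \bar R} := @lebesgue_measure R.

(** Greedy choice: the index at stage [n] shrinks at once the finitely many sets of points missed
    since stage [N], for all [N <= n]. The part of [D] missed from [N] on then has measure at most
    [mu D] times a product that becomes arbitrarily small. [Q] carries side conditions on the
    index. *)
Lemma choose_limsup_full (E : nat -> nat -> set R) (c : nat -> R)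
    (Q : nat -> nat -> Prop) (D : set R) :
  measurable (D : set (measurableTypeR R)) -> (mu D < +oo)%E ->
  (forall n m, measurable (E n m : set (measurableTypeR R))) ->
  (forall n, \forall m \near \oo, Q n m) ->
  (forall n, c n <= 1) ->
  (forall n (F : set R), measurable (F : set (measurableTypeR R)) -> (mu F < +oo)%E ->
    \forall m \near \oo, (mu (F `\` E n m) <= ((1 - c n) * fine (mu F))%:E)%E) ->
  (forall N e, 0 < e -> exists M, \prod_(N <= k < M) (1 - c k) <= e) ->
  exists f : nat -> nat, (forall n, Q n (f n)) /\
    {ae mu, forall x, D x -> forall N, exists2 n, (N <= n)%N & E n (f n) x}.
Proof.
move=> mD Doo mE nearQ c1 nearE divc.
pose ok (A : nat -> set R) :=
  forall N, measurable (A N : set (measurableTypeR R)) /\ A N `<=` D.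
have Aoo A N : ok A -> (mu (A N) < +oo)%E.
  move=> /(_ N)[mA AD]; apply: le_lt_trans Doo.
  by apply: le_measure; rewrite ?inE.
(* The index is chosen for every possible history, so that the recursion can come afterwards. For a
   history that is not [ok] the value 0 is a mere default. *)
have exg (nA : nat * (nat -> set R)) : exists m, ok nA.2 ->
    Q nA.1 m /\ forall N : nat, (N <= nA.1)%N ->
      (mu (nA.2 N `\` E nA.1 m) <= ((1 - c nA.1) * fine (mu (nA.2 N)))%:E)%E.
  case: nA => n A /=; have [okA|nokA] := pselect (ok A); last by exists 0%N.
  have /filter_forall H (N : 'I_n.+1) : \forall m \near \oo,
      (mu (A N `\` E n m) <= ((1 - c n) * fine (mu (A N)))%:E)%E.
    by apply: nearE; [have [] := okA N|exact: Aoo].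
  have [m [Qm Hm]] : exists m, Q n m /\ forall N : 'I_n.+1,
      (mu (A N `\` E n m) <= ((1 - c n) * fine (mu (A N)))%:E)%E.
    by apply: (@filter_ex _ \oo); apply: filterI; [exact: nearQ|exact: H].
  by exists m => _; split => // N Nn; exact: (Hm (Ordinal (Nn : (N < n.+1)%N))).
have [g gP] := choice exg.
(* st n N is the part of D missed by the sets chosen at the stages N, ..., n-1. *)
pose st := fix st n : nat -> set R := if n is k.+1 then
  fun N => if (N <= k)%N then st k N `\` E k (g (k, st k)) else st k N
  else fun=> D.
have stS n N : st n.+1 N = if (N <= n)%N then st n N `\` E n (g (n, st n)) else st n N.
  by [].
have okst n : ok (st n).
  elim: n => [|n IH] N; first by split.
  have [mA AD] := IH N; rewrite stS; case: ifP => // _; split.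
    exact: measurableD.
  by apply: subset_trans AD; exact: subDsetl.
pose f n := g (n, st n); exists f; split.
  by move=> n; have [] := gP (n, st n) (okst n).
have stD n N : (n <= N)%N -> st n N = D.
  elim: n => // n IH nN; rewrite stS leqNgt nN/=; apply: IH; exact: ltnW.
have must N j : fine (mu (st (N + j)%N N)) <=
    fine (mu D) * \prod_(N <= k < N + j) (1 - c k).
  elim: j => [|j IH]; first by rewrite addn0 stD// big_geq// mulr1.
  rewrite addnS big_nat_recr ?leq_addr// stS leq_addr.
  have [_ H] := gP ((N + j)%N, st (N + j)%N) (okst (N + j)%N).
  have {H} := H N (leq_addr _ _); rewrite /= => H.
  rewrite mulrA; apply: le_trans (ler_wpM2r _ IH); last by rewrite subr_ge0.
  rewrite -lee_fin fineK; first by rewrite mulrC.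
  rewrite ge0_fin_numE//; apply: le_lt_trans (Aoo _ N (okst (N + j)%N)).
  have [mst _] := okst (N + j)%N N.
  by apply: le_measure; rewrite ?inE//; exact: measurableD.
pose B N := \bigcap_j st (N + j)%N N.
have mB N : measurable (B N : set (measurableTypeR R)).
  by apply: bigcapT_measurable => j; have [] := okst (N + j)%N N.
have B0 N : mu (B N) = 0%E.
  apply/eqP; rewrite eq_le measure_ge0 andbT; apply/lee_addgt0Pr => e e0.
  have d0 : 0 <= fine (mu D) by exact: fine_ge0.
  have [M HM] := divc N (e / (fine (mu D) + 1)) (divr_gt0 e0 (ltr_wpDl d0 ltr01)).
  rewrite add0e.
  apply: (@le_trans _ _ (mu (st (N + (M - N))%N N))).
    apply: le_measure; rewrite ?inE//; first by have [] := okst (N + (M - N))%N N.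
    exact: bigcap_inf.
  have fs : mu (st (N + (M - N))%N N) \is a fin_num by rewrite ge0_fin_numE//; exact: Aoo.
  rewrite -(fineK fs) lee_fin; apply: (le_trans (must _ _)).
  apply: (@le_trans _ _ (fine (mu D) * (e / (fine (mu D) + 1)))).
    apply: ler_wpM2l => //; have [NM|MN] := leqP N M; first by rewrite subnKC.
    (* Truncated subtraction: for [M < N] both products are empty. *)
    have /eqP-> : (M - N == 0)%N by rewrite subn_eq0 ltnW.
    by move: HM; rewrite addn0 !big_geq// ltnW.
  by rewrite mulrA ler_pdivrMr ?ltr_wpDl// mulrC ler_pM2l// lerDl.
have nB : mu.-negligible (\bigcup_N B N).
  by apply: negligible_bigcup => N; exists (B N); split.
apply: negligibleS nB.
move=> x /= /existsNP[Dx] /existsNP[N HN].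
exists N => // j _; elim: j => [|j IH]; first by rewrite addn0 stD.
rewrite addnS stS leq_addr; split => // Ex; apply: HN.
by exists (N + j)%N => //; exact: leq_addr.
Qed.

(** * Divergence of the sum of [1/(n log n)] and the limsup criterion *)

Lemma ln_sub_le (a b : R) : 0 < a -> 0 < b -> ln b - ln a <= (b - a) / a.
Proof.
move=> a0 b0; rewrite -ln_div ?posrE//.
have -> : b / a = 1 + (b - a) / a by field; rewrite gt_eqF.
by apply: le_ln1Dx; rewrite mulrBl mulfV ?gt_eqF// ltrBrDr addNr divr_gt0.
Qed.

Lemma loglog_unbounded (t : R) : exists N : nat, forall n, (N <= n)%N ->
  expR t <= ln n%:R.
Proof.
have [N _ HN] := nbhs_infty_ger (expR (expR t)).
exists N => n Nn; have en := HN n Nn.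
rewrite -[leLHS]expRK ler_ln ?posrE ?expR_gt0//.
by apply: lt_le_trans en; exact: expR_gt0.
Qed.

(** Since [1 - t <= exp(-t)], it suffices that the sum of [1/((1 + log k) k)] diverges. Its terms
    dominate the increments of [log(1 + log k)], which telescope to an unbounded quantity. *)
Lemma prod_inv_nlogn_vanishes (C : R) N e : 1 <= C -> 0 < e -> exists M,
  \prod_(N <= k < M) (1 - (C * (1 + ln k.+1%:R) * k.+1%:R)^-1) <= e.
Proof.
move=> C1 e0; have C0 : 0 < C by exact: lt_le_trans C1.
pose L k : R := ln (1 + ln k.+1%:R).
have h1 k : 1 <= 1 + ln k.+1%:R :> R by rewrite lerDl ln_ge0// ler1n.
have h0 k : 0 < 1 + ln k.+1%:R :> R by exact: lt_le_trans (h1 k).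
have step k : L k.+1 - L k <= ((1 + ln k.+1%:R) * k.+1%:R)^-1.
  apply: (le_trans (ln_sub_le _ _ (h0 k) (h0 k.+1))).
  rewrite opprD addrACA subrr add0r invfM mulrC ler_pM2l ?invr_gt0//.
  apply: (le_trans (ln_sub_le _ _ (ltr0Sn _ _) (ltr0Sn _ _))).
  by rewrite -[k.+2%:R]natr1 addrAC subrr add0r div1r.
have prodle j : \prod_(N <= k < N + j)
    expR (- (C * (1 + ln k.+1%:R) * k.+1%:R)^-1) <= expR ((L N - L (N + j)%N) / C).
  elim: j => [|j IH]; first by rewrite addn0 big_geq// subrr mul0r expR0.
  rewrite addnS big_nat_recr ?leq_addr//=.
  apply: (le_trans (ler_wpM2r (expR_ge0 _) IH)).
  rewrite -expRD ler_expR -mulrA invfM [C^-1 * _]mulrC -mulrBl ler_pM2r ?invr_gt0//.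
  by have := step (N + j)%N; rewrite -[(N + j).+1]addnS; lra.
have [M HM] := loglog_unbounded (L N - C * ln e).
exists (N + M)%N.
apply: (@le_trans _ _ (\prod_(N <= k < N + M)
    expR (- (C * (1 + ln k.+1%:R) * k.+1%:R)^-1))).
  apply: ler_prod => k _; rewrite expR_ge1Dx andbT subr_ge0.
  rewrite invf_le1 ?mulr_gt0//.
  by rewrite mulr_ege1 ?mulr_ege1// ler1n.
apply: (le_trans (prodle M)).
rewrite -[leRHS]lnK ?posrE// ler_expR ler_pdivrMr//.
have : L N - C * ln e <= L (N + M)%N.
  rewrite -[leLHS]expRK ler_ln ?posrE ?expR_gt0//.
  apply: (@le_trans _ _ (ln (N + M).+1%:R)); last by rewrite lerDr.
  by apply: HM; rewrite ltnW// ltnS leq_addl.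
by lra.
Qed.

Lemma limn_esup_ge1 (u l : nat -> R) (C : R) :
  (forall n, exists2 k, (n <= k)%N & l k - C <= u k) ->
  (forall t : R, exists N : nat, forall n, (N <= n)%N -> t <= l n) ->
  (1%:E <= limn_esup (fun n => (u n / l n)%:E))%E.
Proof.
move=> ul linf; rewrite /limn_esup limf_esupE; apply: le_ereal_inf_tmp.
move=> _ [V [N _ NV] <-]; apply/lee_subgt0Pr => e e0.
(* Beyond this threshold [l k] is positive and [C <= e * l k]. *)
have [N1 HN1] := linf (1 + `|C| / e).
have [k /[!geq_max]/andP[Nk N1k] luk] := ul (maxn N N1).
have lk := HN1 _ N1k.
have Ce : 0 <= `|C| / e by rewrite divr_ge0// ltW.
have l0 : 0 < l k by apply: lt_le_trans lk; rewrite ltr_wpDr.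
apply: (@le_trans _ _ (u k / l k)%:E); last first.
  by apply: ereal_sup_ubound; exists k => //; exact: NV.
rewrite -EFinB lee_fin ler_pdivlMr// mulrBl mul1r; apply: le_trans luk.
rewrite lerD2l lerN2; apply: (le_trans (ler_norm _)).
by rewrite mulrC -ler_pdivrMr//; lra.
Qed.

End LimsupSet.

(** * From nearness to fractions to the distance bound for almost every [x] *)

Lemma min_dist_near_fractions_ge (R : realType) (H : R) (z : R * R) (n P : nat)
    (x : R) : 0 < z.2 -> (0 < n)%N -> (0 < P)%N -> 0 < H ->
  let y := (2 * H * n%:R ^+ 2 * P%:R ^+ 2)^-1 in
  near_fractions n P y x -> ln H - ln (2 * (z.2 + z.2^-1)) <= min_dist z n x y.
Proof.
move=> z2 n0 P0 H0 y [q /= /andP[q0 qP] [p _ xp]].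
have n0R : 0 < n%:R :> R by rewrite ltr0n.
have P0R : 0 < P%:R :> R by rewrite ltr0n.
have y0 : 0 < y by rewrite invr_gt0 !mulr_gt0 ?exprn_gt0.
apply: (@min_dist_ge R H z n q p x y) => //; first by rewrite distrC.
(* The extreme denominator [q = P] turns the height condition into an equality, by the choice of
   [y]. *)
apply: (@le_trans _ _ (2 * (n%:R * P%:R) ^+ 2 * y * H)).
  rewrite ler_pM2r// ler_pM2r// ler_pM2l//.
  rewrite lerXn2r ?nnegrE ?mulr_ge0 ?ler0n//.
  by rewrite natrM ler_pM2l// ler_nat.
rewrite le_eqVlt; apply/orP; left; apply/eqP.
by rewrite /y; field; rewrite !gt_eqF.
Qed.

Theorem theorem1p6 (R : realType) (z0 : R * R) (hz0 : 0 < z0.2)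
  (c : nat -> R) (hc : forall n, 0 < c n) :
  exists y : nat -> R, (forall n, 0 < y n < c n) /\
    {ae (@lebesgue_measure R), forall x : R, 0 <= x < 1 ->
      (1%:E <= limn_esup (fun n : nat =>
                 (min_dist z0 n x (y n) / ln (ln n%:R))%:E))%E}.
Proof.
(* Index [n] stands for [n + 1] throughout the construction. The summand 1 gives [H n >= 1] and
   keeps [H n] above the logarithm. *)
pose H n : R := 1 + ln n.+1%:R.
have H1 n : 1 <= H n by rewrite lerDl ln_ge0// ler1n.
have H0 n : 0 < H n by exact: lt_le_trans (H1 n).
pose y n m := (2 * H n * n.+1%:R ^+ 2 * (16 * m)%:R ^+ 2)^-1 : R.
(* Half of the proportion [1/(128 H n)] available on intervals, as the passage to measurable sets
   loses a factor 2. *)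
pose delta n : R := (256 * H n * n.+1%:R)^-1.
have HN n : 1 <= H n * n.+1%:R by rewrite mulr_ege1// ler1n.
have HN256 n : 1 <= 256 * H n * n.+1%:R.
  by rewrite -mulrA; apply: mulr_ege1; rewrite ?HN ?ler1n.
have HN128 n : 1 <= 128 * H n * n.+1%:R.
  by rewrite -mulrA; apply: mulr_ege1; rewrite ?HN ?ler1n.
have nearQ n : \forall m \near \oo, (0 < m)%N /\ y n m < c n.+1.
  near=> m.
  have [m0 mc] : (0 < m)%N /\ (16 * m)%:R^-1 <= c n.+1.
    by near: m; exact: near_inv_mul16_le.
  split => //; apply: lt_le_trans mc.
  have P1 : 1 <= (16 * m)%:R :> R by rewrite ler1n muln_gt0.
  have P0 : 0 < (16 * m)%:R :> R by exact: lt_le_trans P1.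
  rewrite /y ltf_pV2 ?posrE ?mulr_gt0 ?exprn_gt0//.
  have -> : 2 * H n * n.+1%:R ^+ 2 * (16 * m)%:R ^+ 2 =
    2 * (H n * n.+1%:R * (n.+1%:R * (16 * m)%:R)) * (16 * m)%:R by ring.
  rewrite ltr_pMl//; have : 1 <= H n * n.+1%:R * (n.+1%:R * (16 * m)%:R).
    by rewrite mulr_ege1// mulr_ege1// ler1n.
  by lra.
have mE n m : measurable (near_fractions n.+1 (16 * m) (y n m) : set (measurableTypeR R)).
  by apply: open_measurable; exact: open_near_fractions.
have nearE n (F : set R) : measurable (F : set (measurableTypeR R)) ->
    (lebesgue_measure F < +oo)%E -> \forall m \near \oo,
    (lebesgue_measure (F `\` near_fractions n.+1 (16 * m) (y n m)) <=
      ((1 - delta n) * fine (lebesgue_measure F))%:E)%E.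
  move=> mF Foo; have -> : delta n = (128 * H n * n.+1%:R)^-1 / 2.
    by rewrite /delta; field; rewrite !gt_eqF.
  apply: near_measure_setD_le => //.
    by rewrite invr_gt0 (lt_le_trans ltr01 (HN128 n)) invf_le1 ?HN128// (lt_le_trans ltr01 (HN128 n)).
  move=> a b ab.
  exact: near_lebesgue_measure_itv_setD_near_fractions.
have delta1 n : delta n <= 1.
  by rewrite /delta invf_le1 ?HN256 ?(lt_le_trans ltr01 (HN256 n)).
have D01oo : (lebesgue_measure (`[0%R, 1%R[%classic : set R) < +oo)%E.
  by rewrite lebesgue_measure_itv/= lte_fin ltr01 -EFinB ltry.
have [f [fQ fae]] := choose_limsup_full
  (fun n m => near_fractions n.+1 (16 * m) (y n m)) delta _
  _ (measurable_itv _) D01oo mE nearQ delta1 nearE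
  (fun N e => @prod_inv_nlogn_vanishes R 256 N e (ler1n _ 256)).
(* The value at 0 is arbitrary below [c 0]. *)
exists (fun n => if n is k.+1 then y k (f k) else c 0%N / 2); split.
  case=> [|n]; first by rewrite divr_gt0//= ltr_pdivrMr// ltr_pMr// ltr1n.
  have [m0 ->] := fQ n; have P0 : 0 < (16 * f n)%:R :> R by rewrite ltr0n muln_gt0.
  by rewrite andbT invr_gt0 !mulr_gt0 ?exprn_gt0.
apply: (negligibleS _ fae) => x /= nlim xlim; apply: nlim => x01.
have {x01} /xlim {}xlim : `[0%R, 1%R[%classic x by rewrite /= in_itv.
apply: (limn_esup_ge1 _ _ (ln (2 * (z0.2 + z0.2^-1)))); last first.
  move=> t; have [N HN'] := loglog_unbounded (expR t).
  exists N => n /HN' h; rewrite -[leLHS]expRK ler_ln ?posrE ?expR_gt0//.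
    by apply: le_trans h; rewrite -[leLHS]addr0 (le_trans _ (expR_ge1Dx _))// addrC lerD2r.
  by apply: lt_le_trans h; exact: expR_gt0.
(* Taking [n >= 1] makes [log(n + 1)] positive, so that [log log(n + 1) <= log H n]. *)
move=> N; have [n Nn xE] := xlim (maxn N 1).
move: Nn; rewrite geq_max => /andP[Nn n1].
exists n.+1; first exact: leqW.
have [m0 _] := fQ n.
have P0 : (0 < 16 * f n)%N by rewrite muln_gt0.
have := min_dist_near_fractions_ge _ _ _ _ _ _ hz0 (ltn0Sn n) P0 (H0 n) xE.
rewrite /=; apply: le_trans.
rewrite lerD2r ler_ln ?posrE//; first by rewrite /H lerDr.
by rewrite ln_gt0// ltr1n ltnS.
Unshelve. all: by end_near. Qed.
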